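(* Let $K,L,M$ be positive integers. (Sufficiency) Any mixture model with latent parameters $(F_{1:K};\mathbf{w})\in\Theta_{K,L,M}$ such that $\mathcal{L}_s(F_{1:K};\mathbf{w})\ge 2K-1$ is identifiable. (Converse) For every integer $\overline{L}$ with $0\le\overline{L}\le\min(2K-2,L)$ there is a mixture model with latent parameters $(F_{1:K};\mathbf{w})\in\Theta_{K,L,M}$ which has exactly $\mathcal{L}_s(F_{1:K};\mathbf{w})=\overline{L}$ strongly separable variables and is not identifiable.
   Context: $[N]=\{1,\dots,N\}$. $\Delta_M=\{\mathbf{x}\in\mathbb{R}^M:\sum_{m=1}^M x_m=1,\ x_m>0\ \forall m\in[M]\}$ and $\overline{\Delta}_M$ is its closure. A mixture model has $K$ mixture components and $L$ observed variables, each taking values in a finite set of cardinality $M$; the variables are independent within each component. $\Theta_{K,L,M}$ is the set of latent parameters $(F_{1:K};\mathbf{w})$, where $\mathbf{w}=(w_1,\dots,w_K)\in\Delta_K$ and $F_{1:K}=(F_1,\dots,F_K)$ is an ordered tuple of matrices $F_k=(f_{k\ell m})_{\ell\in[L],m\in[M]}$, each row $\mathbf{f}_{k\ell}=(f_{k\ell 1},\dots,f_{k\ell M})$ of which lies in $\overline{\Delta}_M$ (the distribution of the $\ell$-th variable in the $k$-th component). $\overline{\Theta}_{K,L,M}$ is the closure of $\Theta_{K,L,M}$ (the same, but with $\mathbf{w}\in\overline{\Delta}_K$). The mixture distribution $\mathbf{f}$ of $(F_{1:K};\mathbf{w})\in\overline{\Theta}_{K,L,M}$ is $\mathbf{f}(m_1,\dots,m_L)=\sum_{k=1}^K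 w_k\prod_{\ell=1}^L f_{k\ell m_\ell}$ for $(m_1,\dots,m_L)\in[M]^L$. Write $(F_{1:K};\mathbf{w})\approx(G_{1:K};\mathbf{z})$ if there is a permutation $\pi$ of $[K]$ with $F_k=G_{\pi(k)}$ and $w_k=z_{\pi(k)}$ for all $k\in[K]$. The mixture model with latent parameters $(F_{1:K};\mathbf{w})\in\Theta_{K,L,M}$ and mixture distribution $\mathbf{f}$ is identifiable iff for every $(G_{1:K};\mathbf{z})\in\overline{\Theta}_{K,L,M}$ whose mixture distribution $\mathbf{g}$ satisfies $\mathbf{g}=\mathbf{f}$, we have $(F_{1:K};\mathbf{w})\approx(G_{1:K};\mathbf{z})$. The $\ell$-th variable ($\ell\in[L]$) is strongly separable in $(F_{1:K};\mathbf{w})$ iff for every $m\in[M]$ and all distinct $k,k'\in[K]$, $f_{k\ell m}\ne f_{k'\ell m}$. $\mathcal{L}_s(F_{1:K};\mathbf{w})$ is the number of $\ell\in[L]$ for which the $\ell$-th variable is strongly separable.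
   Formalization: The converse is stated only for K ≥ 2, and with M ≥ 2 unless L̄ = 0: for K = 1 every variable is vacuously strongly separable (so the count is L ≥ 1, not 0), and for M = 1, K ≥ 2 no variable is strongly separable, so the literal claim fails there. *)

(* Defs.v *)
From HB Require Import structures.
From mathcomp Require Import all_boot all_order all_fingroup all_algebra.
From mathcomp Require Import classical_sets boolp reals topology normedtype.

Set Implicit Arguments.
Unset Strict Implicit.
Unset Printing Implicit Defensive.

Import Order.TTheory GRing.Theory Num.Theory.
Import numFieldNormedType.Exports.
Local Open Scope classical_set_scope.
Local Open Scope ring_scope.

Definition simplex (R : realType) (n : nat) : set 'rV[R]_n :=
  [set x | \sum_(i < n) x 0 i = 1 /\ forall i, 0 < x 0 i].

(* The closure is taken in the entrywise (product) topology of 'rV[R]_n. *)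
Definition closed_simplex (R : realType) (n : nat) : set 'rV[R]_n :=
  closure (@simplex R n).

(* An unconstrained pair (F_{1:K}; w): entry (l, m) of [comps p k] is
   f_{k l m}, and [weights p 0 k] is w_k. *)
Record params (R : realType) (K L M : nat) := Params {
  comps : 'I_K -> 'M[R]_(L, M);
  weights : 'rV[R]_K
}.

Section MixtureModel.
Variables (R : realType) (K L M : nat).
Implicit Types p q : params R K L M.

Definition Theta : set (params R K L M) :=
  [set p | (forall k l, closed_simplex (row l (comps p k)))
           /\ simplex (weights p)].

Definition Theta_bar : set (params R K L M) :=
  [set p | (forall k l, closed_simplex (row l (comps p k)))
           /\ closed_simplex (weights p)].

Definition mixture p : {ffun L.-tuple 'I_M -> R} :=
  [ffun m : L.-tuple 'I_M =>
    \sum_(k < K) weights p 0 k * \prod_(l < L) comps p k l (tnth m l)].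

Definition params_equiv p q : Prop :=
  exists pi : {perm 'I_K}, forall k,
    comps p k = comps q (pi k) /\ weights p 0 k = weights q 0 (pi k).

Definition identifiable p : Prop :=
  forall q, Theta_bar q -> mixture q = mixture p -> params_equiv p q.

Definition strongly_separable p (l : 'I_L) : bool :=
  [forall m : 'I_M, forall k : 'I_K, forall k' : 'I_K,
    (k != k') ==> (comps p k l m != comps p k' l m)].

Definition num_strongly_separable p : nat :=
  #|[pred l : 'I_L | strongly_separable p l]|.

End MixtureModel.

(* Main.v *)
Require Import Defs.
From mathcomp Require Import all_boot all_order all_fingroup all_algebra.
From mathcomp Require Import classical_sets boolp reals topology normedtype.
From mathcomp Require Import ring zify finset.

(* Identifiability: among 2K-1 strongly separable variables choose two disjoint
   groups of K-1, and one more variable.  On each group a product of K-1 affine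
   functionals, one killing each of the other components, gives functionals
   phi_i, resp. psi_j, dual to F_1, .., F_K.  Evaluating both mixtures on
   phi_i psi_j, and on phi_i psi_j times an entry of the last variable, forces
   (phi_i(G_k)) to be invertible and to intertwine two diagonal matrices, one
   of them with distinct entries; so it is monomial, and this matches the
   components G_k with the F_i.

   Sharpness: let the rows depend affinely on a parameter t.  The mixture
   probabilities are then integrals of polynomials of degree at most 2K-2 in t,
   and the positive and the negative parts of the binomial coefficients of
   (1 - X)^(2K-1) give two K-point distributions that agree on them. *)

Set Implicit Arguments.
Unset Strict Implicit.
Unset Printing Implicit Defensive.

Import Order.TTheory GRing.Theory Num.Theory.
Import numFieldNormedType.Exports.
Local Open Scope ring_scope.

(** * Preliminaries on closed simplices and finite differences *)

Lemma closed_simplex_sum (R : realType) n (x : 'rV[R]_n) :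
  closed_simplex x -> \sum_i x 0 i = 1.
Proof.
pose f (y : 'rV[R]_n) : R := \sum_i y 0 i.
have cf : continuous f.
  apply: (continuous_big (op := +%R)) => [|i _]; first exact: add_continuous.
  exact: coord_continuous.
have cl : closed (f @^-1` [set 1])%classic.
  apply: (@preimage_closed _ _ f [set (1 : R)]%classic) => [y _|]; [exact: cf|exact: closed_eq].
have sub : (@simplex R n `<=` f @^-1` [set 1])%classic by move=> y [].
by move/(closureS sub); rewrite -((closure_id _).1 cl).
Qed.

(** The forward difference lowers the degree. By Horner induction, the difference of [p * 'X + c] is
    ['X + 1] times the difference of [p], plus [p]. *)
Lemma size_comp_polyX1_sub (R : comNzRingType) (P : {poly R}) :
  (size (P \Po ('X + 1) - P)%R <= (size P).-1)%N.
Proof.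
elim/poly_ind: P => [|p c IH]; first by rewrite comp_poly0 subr0 size_poly0.
have [->|p0] := eqVneq p 0.
  by rewrite mul0r add0r comp_polyC subrr size_poly0.
have -> : (p * 'X + c%:P) \Po ('X + 1) - (p * 'X + c%:P) =
    (p \Po ('X + 1) - p) * ('X + 1) + p.
  by rewrite comp_poly_MXaddC; ring.
have sp : (0 < size p)%N by rewrite size_poly_gt0.
have -> : (size (p * 'X + c%:P)%R).-1 = size p.
  by rewrite size_MXaddC (negPf p0).
apply: (leq_trans (size_polyD _ _)); rewrite geq_max leqnn andbT.
apply: (leq_trans (size_polyMleq _ _)).
by rewrite (size_XaddC 1); move: IH sp; case: (size p) => // k; rewrite addn2.
Qed.

(** Up to sign this is the [n]-th forward difference of [P] at 0. Pascal's rule peels off one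
    difference at a time, and each lowers the size of [P]. *)
Lemma alt_binomial_sum_poly (R : comNzRingType) n (P : {poly R}) :
  (size P <= n)%N ->
  \sum_(i < n.+1) (-1) ^+ i * 'C(n, i)%:R * P.[i%:R] = 0.
Proof.
elim: n P => [|n IH] P sP.
  by move: sP; rewrite leqn0 size_poly_eq0 => /eqP->; rewrite big_ord1 horner0 mulr0.
have E : \sum_(i < n.+2) (-1) ^+ i * 'C(n.+1, i)%:R * P.[i%:R] =
  - \sum_(i < n.+1) (-1) ^+ i * 'C(n, i)%:R * (P \Po ('X + 1) - P).[i%:R].
  rewrite (eq_bigr (fun i : 'I_n.+1 => (-1) ^+ i * 'C(n, i)%:R * P.[i.+1%:R]
     - (-1) ^+ i * 'C(n, i)%:R * P.[i%:R])); last first.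
    move=> i _; rewrite hornerD hornerN horner_comp !hornerE -mulrBr.
    by rewrite -natr1.
  rewrite sumrB opprB big_ord_recl /= expr0 bin0 [in RHS]big_ord_recl /=.
  rewrite expr0 bin0 -addrA; congr (_ + _).
  rewrite (eq_bigr (fun i : 'I_n.+1 => (-1) ^+ i.+1 * 'C(n, i.+1)%:R * P.[i.+1%:R]
     - (-1) ^+ i * 'C(n, i)%:R * P.[i.+1%:R])); last first.
    by move=> i _; rewrite /= /bump /= add1n binS natrD exprS; ring.
  rewrite sumrB; congr (_ - _); rewrite big_ord_recr /= bin_small // mulr0 mul0r addr0.
  by apply: eq_bigr.
rewrite E IH ?oppr0 //.
by apply: (leq_trans (size_comp_polyX1_sub _)); lia.
Qed.

(** * Test functionals that are multilinear in the rows *)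

Section Tests.
Variables (R : realType) (L M : nat).
Implicit Types (S T : {set 'I_L}) (f g : 'M[R]_(L, M) -> R).

Definition unit_row_sums (F : 'M[R]_(L, M)) : Prop := forall l, \sum_m F l m = 1.

(** Restricting to unit row sums lets a constant count as a linear form in a row, so that affine
    factors and rows outside [S] fit the same format. *)
Definition multilinear_on S f := exists u : 'I_L -> 'I_M -> R,
  forall F, unit_row_sums F -> f F = \prod_(l in S) \sum_m u l m * F l m.

Lemma multilinear_on_sub S T f :
  S \subset T -> multilinear_on S f -> multilinear_on T f.
Proof.
move=> ST [u uP]; exists (fun l m => if l \in S then u l m else 1) => F sF.
rewrite uP // [RHS](big_setID S) /= (setIidPr ST) [X in _ = _ * X]big1 ?mulr1.
  by apply: eq_bigr => l ->.
move=> l; rewrite inE => /andP[/negPf-> _].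
by rewrite -[RHS](sF l); apply: eq_bigr => m _; rewrite mul1r.
Qed.

Lemma multilinear_on1 S : multilinear_on S (fun=> 1).
Proof.
apply: (@multilinear_on_sub set0); first exact: sub0set.
by exists (fun _ _ => 0) => F _; rewrite big_set0.
Qed.

Lemma multilinear_on_mul S T f g : [disjoint S & T] ->
  multilinear_on S f -> multilinear_on T g ->
  multilinear_on (S :|: T) (fun F => f F * g F).
Proof.
move=> dST [u uP] [v vP]; exists (fun l m => if l \in S then u l m else v l m) => F sF.
rewrite uP // vP // [RHS](eq_bigl [predU S & T]) => [|l]; last by rewrite !inE.
rewrite bigU //=; congr (_ * _); apply: eq_bigr => l.
  by move=> ->.
by move=> lT; rewrite (disjointFl dST).
Qed.

Lemma multilinear_on_entry l m a b :
  multilinear_on [set l] (fun F => (F l m - a) / b).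
Proof.
exists (fun _ m' => ((m' == m)%:R - a) / b) => F sF; rewrite big_set1.
under eq_bigr do rewrite mulrAC mulrBl.
rewrite -mulr_suml sumrB -mulr_sumr sF mulr1; congr ((_ - _) / _).
rewrite (bigD1 m) //= eqxx mul1r big1 ?addr0 // => i /negPf->.
by rewrite mul0r.
Qed.

Lemma multilinear_on_prod n (alpha : 'I_n -> 'I_L)
    (h : 'I_n -> 'M[R]_(L, M) -> R) :
  injective alpha -> (forall j, multilinear_on [set alpha j] (h j)) ->
  multilinear_on (alpha @: setT) (fun F => \prod_j h j F).
Proof.
move=> ia /choice[u uP].
(* Injectivity of [alpha] makes the picked index unique; the default 0 is never met on the image. *)
exists (fun l m => if [pick j | alpha j == l] is Some j then u j l m else 0) => F sF.
rewrite big_imset /=; last by move=> ? ? _ _; exact: ia.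
apply: eq_big => [j|j _]; first by rewrite inE.
rewrite uP // big_set1; case: pickP => [i /eqP/ia-> //|/(_ j)].
by rewrite eqxx.
Qed.

(** Once [S] is widened to all variables, expanding the product of sums turns each side into the
    same linear combination of mixture probabilities. *)
Lemma mixture_multilinear K (p q : params R K L M) S f :
  (forall k, unit_row_sums (comps p k)) ->
  (forall k, unit_row_sums (comps q k)) ->
  mixture p = mixture q -> multilinear_on S f ->
  \sum_k weights p 0 k * f (comps p k) = \sum_k weights q 0 k * f (comps q k).
Proof.
move=> sp sq epq /(multilinear_on_sub (subsetT S))[u uP].
suff E (r : params R K L M) : (forall k, unit_row_sums (comps r k)) ->
    \sum_k weights r 0 k * f (comps r k) =
    \sum_(m : {ffun 'I_L -> 'I_M}) (\prod_l u l (m l)) * mixture r [tuple m l | l < L].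
  by rewrite !E // epq.
move=> sr; under [RHS]eq_bigr do rewrite ffunE mulr_sumr.
rewrite [RHS]exchange_big /=; apply: eq_bigr => k _.
rewrite uP //; under eq_bigl do rewrite inE.
rewrite bigA_distr_bigA /= mulr_sumr; apply: eq_bigr => m _.
rewrite mulrCA -big_split /=; congr (_ * _); apply: eq_bigr => l _.
by rewrite tnth_mktuple.
Qed.

End Tests.


(** * Simultaneous diagonalization *)

Section JointDiagonalization.
Variables (R : fieldType) (K : nat).

(* Both hypotheses say that P diag(z) Q^T = diag(w) and P diag(z) diag(g) Q^T =
   diag(w) diag(f). Hence P diag(g) = diag(f) P with P invertible, and
   distinctness of the f i makes P monomial. *)
Lemma joint_diagonalization (P Q : 'M[R]_K) (w z f g : 'I_K -> R) :
  (forall i, w i != 0) -> injective f ->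
  (forall i j, \sum_k z k * (P i k * Q j k) = w i * (i == j)%:R) ->
  (forall i j, \sum_k z k * (P i k * Q j k * g k) = w i * f i * (i == j)%:R) ->
  exists s : {perm 'I_K}, forall i k, i != s k -> P i k = 0 /\ Q i k = 0.
Proof.
move=> w0 injf H1 H2.
pose Q' : 'M[R]_K := \matrix_(k, j) (z k * Q j k / w j).
have PQ : P *m Q' = 1%:M.
  apply/matrixP => i j; rewrite !mxE.
  under eq_bigr do rewrite mxE mulrA (mulrCA (P i _)).
  rewrite -mulr_suml H1; have [->|] := eqVneq i j; last by rewrite mulr0 mul0r.
  by rewrite mulr1 divff.
have QP := mulmx1C PQ.
have Pg i k : P i k * g k = f i * P i k.
  have E : P *m diag_mx (\row_k g k) *m Q' = diag_mx (\row_k f k).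
    apply/matrixP => i' j; rewrite !mxE.
    under eq_bigr do rewrite mul_mx_diag !mxE.
    rewrite (eq_bigr (fun k' => z k' * (P i' k' * Q j k' * g k') / w j)); last first.
      by move=> k' _; ring.
    rewrite -mulr_suml H2 mulrb; have [->|] := eqVneq i' j; last by rewrite mulr0 mul0r.
    by rewrite mulr1 mulrAC divff ?mul1r.
  move/(congr1 (mulmx^~ P)): E; rewrite -mulmxA QP mulmx1 => /matrixP/(_ i k).
  by rewrite mul_mx_diag mul_diag_mx !mxE.
have ex k : exists i, P i k != 0.
  apply/existsP; rewrite -[X in is_true X]negbK negb_exists; apply/negP => /forallP Pk.
  have /matrixP/(_ k k) := QP; rewrite !mxE eqxx big1 => [/eqP|i _].
    by rewrite eq_sym oner_eq0.
  by move: (Pk i); rewrite negbK => /eqP->; rewrite mulr0.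
(* A nonzero [P i k] forces [f i = g k], so by distinctness of the [f i] column [k] has its only
   nonzero entry in row [s k]. *)
pose s k := xchoose (ex k).
have sP k : P (s k) k != 0 by exact: (xchooseP (ex k)).
have fs i k : P i k != 0 -> f i = g k.
  by move=> Pik; apply: (mulIf Pik); rewrite -Pg mulrC.
have P0 i k : i != s k -> P i k = 0.
  move=> ne; apply/eqP; apply: contraNT ne => /fs fi.
  by apply/eqP/injf; rewrite fi; apply/esym/fs/sP.
have surj i : exists k, i == s k.
  apply/existsP; rewrite -[X in is_true X]negbK negb_exists; apply/negP => /forallP Pi.
  have /esym/eqP := H1 i i; rewrite eqxx mulr1 big1 ?(negPf (w0 i)) // => k _.
  by rewrite P0 // mul0r mulr0.
(* A surjective self-map of a finite set is injective: its section [t] is injective, hence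
   bijective. *)
have injs : injective s.
  pose t i := xchoose (surj i).
  have st : cancel t s by move=> i; apply/esym/eqP/(xchooseP (surj i)).
  have [t' t'K tK] := injF_bij (can_inj st).
  have E : s =1 t' by move=> x; rewrite -{1}(tK x) st.
  by move=> x y; rewrite !E; apply: can_inj tK _ _.
exists (perm injs) => i k; rewrite permE => ne; split; first exact: P0.
(* Row [s k] of [P] is zero outside column [k]. The single remaining term of [H1] shows that [z k]
   is nonzero, and then that [Q i k] vanishes. *)
have sum1 j : \sum_k' z k' * (P (s k) k' * Q j k') = z k * (P (s k) k * Q j k).
  rewrite (bigD1 k) //= big1 ?addr0 // => k' nk.
  by rewrite P0 ?mul0r ?mulr0 // (inj_eq injs) eq_sym.
have := H1 (s k) i; rewrite sum1 eq_sym (negPf ne) mulr0 => /eqP.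
rewrite !mulf_eq0 (negPf (sP k)) /= => /orP[/eqP z0|/eqP//].
have := H1 (s k) (s k); rewrite sum1 z0 mul0r eqxx mulr1 => /esym/eqP.
by rewrite (negPf (w0 _)).
Qed.

End JointDiagonalization.

(** * Sufficiency of 2K-1 strongly separable variables, with K = n + 1 *)

Section Sufficiency.
Variables (R : realType) (n L M : nat).
Implicit Types p q : params R n.+1 L M.

(* Lagrange interpolation: the i-th functional is the product over k != i of
   the (f_{l m0} - f_{k l m0}) / (f_{i l m0} - f_{k l m0}), one variable l for
   each k. *)
Lemma dual_functionals p (m0 : 'I_M) (alpha : 'I_n -> 'I_L) :
  injective alpha -> (forall j, strongly_separable p (alpha j)) ->
  exists phi : 'I_n.+1 -> 'M[R]_(L, M) -> R,
    (forall i, multilinear_on (alpha @: setT) (phi i)) /\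
    (forall i k, phi i (comps p k) = (i == k)%:R).
Proof.
move=> ia sep.
(* [lift i] enumerates the components other than [i]; variable [alpha j] is used to kill component
   [lift i j]. *)
pose a i j := comps p (lift i j) (alpha j) m0.
exists (fun i F => \prod_j ((F (alpha j) m0 - a i j) /
   (comps p i (alpha j) m0 - a i j))); split => i.
  apply: (multilinear_on_prod (h := fun j F => ((F (alpha j) m0 - a i j) /
   (comps p i (alpha j) m0 - a i j)))) => // j.
  exact: multilinear_on_entry.
move=> k; have [<-|ne] := eqVneq i k.
  rewrite big1 // => j _; rewrite divff // subr_eq0.
  have /forallP/(_ m0)/forallP/(_ i)/forallP/(_ (lift i j))/implyP := sep j.
  by apply; exact: neq_lift.
have [j ->] := unlift_some ne.
by rewrite (bigD1 j) //= /a subrr mul0r mul0r.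
Qed.

(** Testing with [psi (s k)] times [h] isolates one component on each side. Taking [h] constant
    compares the weights; taking [h] an entry of a variable outside [S] then compares the
    components. *)
Lemma recover_off_support p q (S : {set 'I_L})
    (psi : 'I_n.+1 -> 'M[R]_(L, M) -> R) (s : {perm 'I_n.+1}) :
  (forall k, unit_row_sums (comps p k)) ->
  (forall k, unit_row_sums (comps q k)) ->
  mixture p = mixture q -> (forall k, weights p 0 k != 0) ->
  (forall i, multilinear_on S (psi i)) ->
  (forall i k, psi i (comps p k) = (i == k)%:R) ->
  (forall i k, i != s k -> psi i (comps q k) = 0) ->
  forall k, weights q 0 k * psi (s k) (comps q k) = weights p 0 (s k) /\
    forall l m, l \notin S -> comps q k l m = comps p (s k) l m.
Proof.
move=> sp sq epq w0 psiS psip psiq k.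
have sump (h : 'M[R]_(L, M) -> R) :
    \sum_k' weights p 0 k' * (psi (s k) (comps p k') * h (comps p k')) =
    weights p 0 (s k) * h (comps p (s k)).
  rewrite (bigD1 (s k)) //= psip eqxx mul1r big1 ?addr0 // => k' /negPf ne.
  by rewrite psip eq_sym ne mul0r mulr0.
have sumq (h : 'M[R]_(L, M) -> R) :
    \sum_k' weights q 0 k' * (psi (s k) (comps q k') * h (comps q k')) =
    weights q 0 k * psi (s k) (comps q k) * h (comps q k).
  rewrite (bigD1 k) //= big1 ?addr0 ?mulrA // => k' ne.
  by rewrite psiq ?mul0r ?mulr0 // (inj_eq perm_inj) eq_sym.
have transfer (S' : {set 'I_L}) (h : 'M[R]_(L, M) -> R) : [disjoint S & S'] -> multilinear_on S' h ->
    weights p 0 (s k) * h (comps p (s k)) =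
    weights q 0 k * psi (s k) (comps q k) * h (comps q k).
  move=> dS hS; rewrite -sump -sumq.
  exact: (mixture_multilinear sp sq epq (multilinear_on_mul dS (psiS _) hS)).
have E : weights q 0 k * psi (s k) (comps q k) = weights p 0 (s k).
  have dS : [disjoint S & set0] by rewrite -setI_eq0 setI0.
  by have := transfer _ _ dS (multilinear_on1 R M set0); rewrite !mulr1.
split=> // l m lS.
have dS : [disjoint S & [set l]] by rewrite disjoint_sym disjoints1.
have := transfer _ _ dS (multilinear_on_entry _ m 0 1).
by rewrite !subr0 !divr1 E => /(mulfI (w0 (s k))).
Qed.

Lemma enough_separable_identifiable p : (0 < M)%N -> Theta p ->
  (2 * n + 1 <= num_strongly_separable p)%N -> identifiable p.
Proof.
move=> hM [rp [wsum wpos]] hsep q [rq _] epq.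
have sp k : unit_row_sums (comps p k).
  by move=> l; rewrite -(closed_simplex_sum (rp k l)); apply: eq_bigr => m _; rewrite mxE.
have sq k : unit_row_sums (comps q k).
  by move=> l; rewrite -(closed_simplex_sum (rq k l)); apply: eq_bigr => m _; rewrite mxE.
have w0 k : weights p 0 k != 0 by rewrite gt_eqF.
pose m0 := Ordinal hM.
have [e [ie se]] : exists e : 'I_(n + n + 1) -> 'I_L,
    injective e /\ forall i, strongly_separable p (e i).
  have le : (n + n + 1 <= #|[pred l | strongly_separable p l]|)%N.
    by apply: leq_trans hsep; lia.
  exists (fun i => enum_val (widen_ord le i)); split.
    by move=> i j /enum_val_inj/(congr1 val)/= /val_inj.
  by move=> i; have := enum_valP (widen_ord le i).
pose alpha j := e (lshift 1 (lshift n j)).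
pose beta j := e (lshift 1 (rshift n j)).
pose c := e (rshift (n + n) ord0).
have ia : injective alpha by move=> i j /ie/lshift_inj/lshift_inj.
have ib : injective beta by move=> i j /ie/lshift_inj/rshift_inj.
have dab : [disjoint alpha @: setT & beta @: setT].
  rewrite disjoint_subset; apply/fintype.subsetP => l /imsetP[i _ ->]; rewrite inE.
  by apply/imsetP => -[j _ /ie/lshift_inj/eqP]; rewrite eq_lrshift.
have dabc : [disjoint alpha @: setT :|: beta @: setT & [set c]].
  rewrite disjoint_sym disjoints1 inE negb_or; apply/andP; split;
  by apply/imsetP => -[j _ /ie/eqP]; rewrite eq_rlshift.
have [phi [phiS phip]] := dual_functionals m0 ia (fun j => se _).
have [psi [psiS psip]] := dual_functionals m0 ib (fun j => se _).
have [|i j|i j|s sP] := @joint_diagonalization R n.+1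
  (\matrix_(i, k) phi i (comps q k)) (\matrix_(i, k) psi i (comps q k))
  (weights p 0) (weights q 0) (fun k => comps p k c m0) (fun k => comps q k c m0) w0.
- move=> k k' E; apply/eqP; have /forallP/(_ m0)/forallP/(_ k)/forallP/(_ k') := se (rshift (n + n) ord0).
  by apply: contraTT => ne; rewrite ne /= E eqxx.
- under eq_bigr do rewrite !mxE.
  rewrite -(mixture_multilinear sp sq (esym epq)
    (multilinear_on_mul dab (phiS i) (psiS j))).
  rewrite (bigD1 i) //= !phip !psip eqxx mul1r (eq_sym j) big1 ?addr0 // => k ne.
  by rewrite phip eq_sym (negPf ne) mul0r mulr0.
- under eq_bigr do rewrite !mxE.
  have := mixture_multilinear sp sq (esym epq) (multilinear_on_mul dabc
    (multilinear_on_mul dab (phiS i) (psiS j)) (multilinear_on_entry _ m0 0 1)).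
  under [X in _ = X -> _]eq_bigr do rewrite subr0 divr1.
  move=> <-; rewrite (bigD1 i) //= !phip !psip eqxx mul1r (eq_sym j) big1 => [|k ne].
    by rewrite addr0 subr0 divr1 mulrA mulrAC.
  by rewrite phip eq_sym (negPf ne) !mul0r mulr0.
(* [phi] recovers the variables outside the image of [alpha], [psi] those outside the image of
   [beta]; as the images are disjoint, no variable is missed. *)
have offa := recover_off_support sp sq (esym epq) w0 phiS phip (s := s)
  (fun i k ne => ltac:(by have := (sP i k ne).1; rewrite mxE)).
have offb := recover_off_support sp sq (esym epq) w0 psiS psip (s := s)
  (fun i k ne => ltac:(by have := (sP i k ne).2; rewrite mxE)).
have comps_eq k : comps q k = comps p (s k).
  apply/matrixP => l m; have [la|la] := boolP (l \in alpha @: setT).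
    by apply: (offb k).2; rewrite (disjointFr dab).
  exact: (offa k).2.
exists (s^-1)%g => k; rewrite comps_eq permKV; split=> //.
(* With the components matched, the dual functional takes the value 1 on both sides, so the weights
   agree. *)
have [] := offa (s^-1 k)%g.
by rewrite comps_eq permKV phip eqxx mulr1 => ->.
Qed.

End Sufficiency.

(** * Converse: non-identifiable models *)

Section Converse.
Variable R : realType.

Lemma big_ord_parity (n : nat) (F : nat -> R) :
  \sum_(i < 2 * n) (-1) ^+ i * F i =
  \sum_(k < n) F (2 * k)%N - \sum_(k < n) F (2 * k).+1.
Proof.
elim: n => [|n IH]; first by rewrite muln0 !big_ord0 subr0.
rewrite mulnS !add2n !big_ord_recr /= IH exprS exprM sqrrN expr1n expr1n.
by ring.
Qed.

(* The sample points 0, .., 2K-1, weighted by the coefficients of (1 - X)^(2K-1),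
   annihilate polynomials of degree at most 2K-2; the two sides collect the
   positive and the negative weights. *)
Lemma alternating_binomial_moments K L (a b : 'I_L -> R) :
  (#|[pred l | b l != 0%R]| < 2 * K - 1)%N ->
  \sum_(k < K) 'C(2 * K - 1, 2 * k)%:R * \prod_l (a l + b l * (2 * k)%:R) =
  \sum_(k < K) 'C(2 * K - 1, (2 * k).+1)%:R * \prod_l (a l + b l * (2 * k).+1%:R).
Proof.
move=> hb.
pose P : {poly R} := \prod_l ((a l)%:P + b l *: 'X).
have hP x : P.[x] = \prod_l (a l + b l * x).
  by rewrite horner_prod; apply: eq_bigr => l _; rewrite !hornerE.
have sP : (size P <= 2 * K - 1)%N.
  (* A factor with [b l = 0] is constant, so the degree of [P] is at most the number of nonzero
     [b l]. *)
  have s1 (l : 'I_L) : (size ((a l)%:P + b l *: 'X)%R <= 1 + (b l != 0%R))%N.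
    apply: (leq_trans (size_polyD _ _)); rewrite geq_max; apply/andP; split.
      by apply: (leq_trans (size_polyC_leq1 _)).
    have [->|_] := eqVneq (b l) 0; first by rewrite scale0r size_poly0.
    by apply: (leq_trans (size_scale_leq _ _)); rewrite size_polyX.
  apply: leq_trans (size_poly_prod_leq _ _) _.
  have := leq_sum (index_enum 'I_L) (fun l (_ : true) => s1 l).
  rewrite big_split /= sum1_card -big_mkcond /= sum1_card => H.
  apply: leq_trans (leq_sub2r _ (H : (_ < _.+1)%N)) _.
  by rewrite -addnS addKn.
have := alt_binomial_sum_poly sP.
have -> : (2 * K - 1).+1 = (2 * K)%N by lia.
under eq_bigr do rewrite -mulrA.
rewrite (big_ord_parity K (fun i => 'C(2 * K - 1, i)%:R * P.[i%:R])) => /subr0_eq.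
by under eq_bigr do rewrite hP; under [X in _ = X -> _]eq_bigr do rewrite hP.
Qed.

(** The moment identity with no variables. It gives the even and the odd weights the same
    normalizing constant. *)
Lemma alternating_binomial_sum K : (1 < K)%N ->
  \sum_(k < K) 'C(2 * K - 1, 2 * k)%:R = \sum_(k < K) 'C(2 * K - 1, (2 * k).+1)%:R :> R.
Proof.
move=> K1; have := @alternating_binomial_moments K 0 (fun=> 0) (fun=> 0).
under eq_bigr do rewrite big_ord0 mulr1.
under [X in _ = X]eq_bigr do rewrite big_ord0 mulr1.
by apply; rewrite eq_card0 => [|l]; [lia|rewrite !inE eqxx].
Qed.

Lemma card_ord_lt L n : (n <= L)%N -> #|[pred l : 'I_L | (l < n)%N]| = n.
Proof.
move=> nL; rewrite -sum1_card (eq_bigl (fun l : 'I_L => (l < n)%N)) => [|l]; last by rewrite inE.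
by rewrite -(big_ord_widen L (fun=> 1%N) nL) sum1_card card_ord.
Qed.

Lemma simplex_Theta K L M (p : params R K L M) :
  (forall k l, \sum_m comps p k l m = 1 /\ forall m, 0 < comps p k l m) ->
  simplex (weights p) -> Theta p.
Proof.
move=> h hw; split=> // k l; apply: subset_closure.
have [s1 pos] := h k l; split=> [|m]; last by rewrite mxE.
by rewrite -[RHS]s1; apply: eq_bigr => m _; rewrite mxE.
Qed.

Lemma Theta_sub_bar K L M (p : params R K L M) : Theta p -> Theta_bar p.
Proof. by move=> [h1 h2]; split=> //; apply: subset_closure. Qed.

(** When all components are the same uniform one, the mixture does not see the weights. Uniform
    weights and weights favouring one component are not permutations of each other. *)
Lemma nonidentifiable_no_separable K L M : (1 < K)%N -> (0 < M)%N ->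
  exists p : params R K L M,
    [/\ Theta p, num_strongly_separable p = 0%N & ~ identifiable p].
Proof.
case: K => // K K1 M0; have Mr : M%:R != 0 :> R by rewrite pnatr_eq0 -lt0n.
pose F : 'M[R]_(L, M) := \matrix_(l, m) M%:R^-1.
have hF l : \sum_m F l m = 1 /\ forall m, 0 < F l m.
  split=> [|m]; last by rewrite mxE invr_gt0 ltr0n.
  under eq_bigr do rewrite mxE.
  by rewrite sumr_const card_ord -[_ *+ _]mulr_natl divff.
pose k1 : 'I_K.+1 := Ordinal K1.
pose w : 'rV[R]_K.+1 := \row_k ((1 + (k == ord0)%:R) / K.+2%:R).
pose z : 'rV[R]_K.+1 := \row_k K.+1%:R^-1.
have sw : simplex w.
  split=> [|k]; last by rewrite mxE divr_gt0 ?ltr0n // ltr_pwDl ?ler0n.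
  under eq_bigr do rewrite mxE.
  rewrite -mulr_suml big_split /= sumr_const card_ord (bigD1 ord0) //= big1 => [|k /negPf->//].
  by rewrite addr0 -mulrSr divff // pnatr_eq0.
have sz : simplex z.
  split=> [|k]; last by rewrite mxE invr_gt0 ltr0n.
  under eq_bigr do rewrite mxE.
  by rewrite sumr_const card_ord -[_ *+ _]mulr_natl divff // pnatr_eq0.
exists (Params (fun=> F) w); split.
- exact: simplex_Theta.
- apply: eq_card0 => l; rewrite !inE; apply/negP => /forallP/(_ (Ordinal M0)).
  by move=> /forallP/(_ ord0)/forallP/(_ k1)/implyP/(_ isT)/eqP.
move=> /(_ (Params (fun=> F) z)) [].
- by apply/Theta_sub_bar/simplex_Theta.
- by apply/ffunP => m; rewrite !ffunE /= -!mulr_suml sz.1 sw.1.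
move=> s hs; have [_ h0] := hs ord0; have [_ h1] := hs k1.
move: h1; rewrite /= !mxE; move: h0; rewrite /= !mxE => <- /eqP.
by rewrite eqxx -subr_eq0 -mulrBl mulf_eq0 invr_eq0 pnatr_eq0 orbF addr0 opprD addNKr oppr_eq0 oner_eq0.
Qed.

(** The first [Lbar] rows move injectively in every entry along a line with parameter [i]; the
    others stay uniform. Even [i] give the components of [p], odd [i] those of [q]. *)
Lemma nonidentifiable_separable K L m Lbar : (1 < K)%N ->
  (0 < Lbar)%N -> (Lbar <= 2 * K - 2)%N -> (Lbar <= L)%N ->
  exists p : params R K L m.+2,
    [/\ Theta p, num_strongly_separable p = Lbar & ~ identifiable p].
Proof.
move=> K1 Lb0 LbK LbL.
(* [D] exceeds [i + 1] for all sample points [i < 2 * K], which keeps [1 - (i + 1) / D] positive. *)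
pose D : R := (2 * K + 1)%:R.
have D0 : 0 < D by rewrite ltr0n; lia.
have m0 : 0 < m.+1%:R :> R by rewrite ltr0n.
pose b (l : 'I_L) (j : 'I_m.+2) : R :=
  if (l < Lbar)%N then if j == ord0 then - D^-1 else (D * m.+1%:R)^-1 else 0.
(* The extra [b l j] shifts the parameter to [i + 1], so that no entry vanishes at [i = 0]. *)
pose a (l : 'I_L) (j : 'I_m.+2) : R :=
  if (l < Lbar)%N then b l j + (j == ord0)%:R else m.+2%:R^-1.
pose F (i : nat) : 'M[R]_(L, m.+2) := \matrix_(l, j) (a l j + b l j * i%:R).
have FE i l j : F i l j = if (l < Lbar)%N then
    if j == ord0 then 1 - i.+1%:R / D else i.+1%:R / (D * m.+1%:R)
  else m.+2%:R^-1.
  rewrite mxE /a /b; case: ifP => lL; last by rewrite mul0r addr0.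
  by rewrite lL -[i.+1%:R]natr1; case: eqP => _ /=; ring.
have b0 (l : 'I_L) j : (l < Lbar)%N -> b l j != 0.
  move=> lL; rewrite /b lL; case: ifP => _; rewrite ?oppr_eq0 invr_eq0 ?mulf_neq0 //;
  by rewrite gt_eqF.
have hF i l : (i < 2 * K)%N -> \sum_j F i l j = 1 /\ forall j, 0 < F i l j.
  move=> iK; have iD : i.+1%:R < D by rewrite ltr_nat; lia.
  split=> [|j]; last first.
    rewrite FE; case: ifP => _; last by rewrite invr_gt0 ltr0n.
    case: ifP => _; first by rewrite subr_gt0 ltr_pdivrMr ?mul1r.
    by rewrite divr_gt0 ?ltr0n // mulr_gt0.
  under eq_bigr do rewrite FE.
  have [_|_] := boolP (l < Lbar)%N; last first.
    by rewrite sumr_const card_ord -[_ *+ _]mulr_natl divff // pnatr_eq0.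
  rewrite big_ord_recl eqxx /= sumr_const card_ord -[X in _ + X]mulr_natr.
  by rewrite invfM mulrA mulfVK ?subrK // gt_eqF.
pose N := (2 * K - 1)%N.
pose W : R := \sum_(k < K) 'C(N, 2 * k)%:R.
have WE : W = \sum_(k < K) 'C(N, (2 * k).+1)%:R by exact: alternating_binomial_sum.
have W0 : 0 < W.
  rewrite /W (bigD1 (Ordinal (ltnW K1))) //= muln0 bin0.
  by rewrite ltr_pwDl // sumr_ge0.
pose p : params R K L m.+2 :=
  Params (fun k => F (2 * k)%N) (\row_k ('C(N, 2 * k)%:R / W)).
pose q : params R K L m.+2 :=
  Params (fun k => F (2 * k).+1) (\row_k ('C(N, (2 * k).+1)%:R / W)).
have Tp : Theta p.
  apply: simplex_Theta => [k l|]; first by apply: hF; have := ltn_ord k; lia.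
  split=> [|k]; last first.
    by rewrite mxE divr_gt0 // ltr0n bin_gt0; have := ltn_ord k; rewrite /N; lia.
  by under eq_bigr do rewrite mxE; rewrite -mulr_suml divff // gt_eqF.
have Tq : Theta q.
  apply: simplex_Theta => [k l|]; first by apply: hF; have := ltn_ord k; lia.
  split=> [|k]; last first.
    by rewrite mxE divr_gt0 // ltr0n bin_gt0; have := ltn_ord k; rewrite /N; lia.
  by under eq_bigr do rewrite mxE; rewrite -mulr_suml -WE divff // gt_eqF.
have injF i i' (l : 'I_L) j : (l < Lbar)%N -> F i l j = F i' l j -> i = i'.
  move=> lL; rewrite !mxE => /addrI/(mulfI (b0 l j lL))/eqP.
  by rewrite eqr_nat => /eqP.
exists p; split=> //; [|].
- rewrite -[RHS](card_ord_lt LbL); apply: eq_card => l; rewrite !inE.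
  have [lL|lL] := boolP (l < Lbar)%N.
    apply/forallP => j; apply/forallP => k; apply/forallP => k'; apply/implyP.
    by apply: contraNneq => /(injF _ _ _ _ lL) E; apply/eqP/val_inj => /=; lia.
  apply/negP => /forallP/(_ ord0)/forallP/(_ (Ordinal (ltnW K1)))/forallP/(_ (Ordinal K1))/implyP.
  by move=> /(_ isT)/eqP; rewrite /= !FE (negPf lL).
move=> /(_ q) [].
- exact: Theta_sub_bar.
- apply/ffunP => t; rewrite !ffunE /=.
  under eq_bigr do rewrite mxE mulrAC.
  under [RHS]eq_bigr do rewrite mxE mulrAC.
  rewrite -!mulr_suml; congr (_ / _); apply/esym.
  have FP i : \prod_(l < L) F i l (tnth t l) =
      \prod_(l < L) (a l (tnth t l) + b l (tnth t l) * i%:R).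
    by apply: eq_bigr => l _; rewrite mxE.
  under [RHS]eq_bigr do rewrite FP; under [LHS]eq_bigr do rewrite FP.
  (* Only the rows [l < Lbar] depend on [i], and [Lbar] is at most 2K-2. *)
  apply: alternating_binomial_moments; apply: (@leq_ltn_trans Lbar); last by lia.
  rewrite -[X in (_ <= X)%N](card_ord_lt LbL); apply/subset_leq_card/fintype.subsetP => l.
  by rewrite !inE; apply: contraNT => lL; rewrite /b (negPf lL).
pose l0 : 'I_L := Ordinal (leq_trans Lb0 LbL).
(* Matching components would have equal sample points, one even and one odd. *)
move=> s /(_ (Ordinal (ltnW K1)))[/matrixP/(_ l0 ord0)/(injF _ _ l0 _ Lb0)/=].
by lia.
Qed.

End Converse.

(* For K = 1 every variable is strongly separable and every model is
   identifiable; for M = 1 < K no variable is strongly separable. So the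
   converse is false when K = 1, and when M = 1 and Lbar > 0:
   exactly these cases are excluded, and only from the converse. *)
Theorem theorem1 (R : realType) (K L M : nat)
    (hK : (0 < K)%N) (hL : (0 < L)%N) (hM : (0 < M)%N) :
  (forall p : params R K L M, Theta p ->
     (2 * K - 1 <= num_strongly_separable p)%N -> identifiable p)
  /\
  (forall Lbar : nat, (Lbar <= minn (2 * K - 2) L)%N ->
     (1 < K)%N -> ((1 < M)%N \/ Lbar = 0%N) ->
     exists p : params R K L M,
       [/\ Theta p, num_strongly_separable p = Lbar & ~ identifiable p]).

Proof.
split=> [p Tp sep|Lbar].
  case: K hK p Tp sep => // n _ p Tp sep.
  by apply: enough_separable_identifiable => //; apply: leq_trans sep; lia.
rewrite leq_min => /andP[LbK LbL] K1; have [->|Lb0] := posnP Lbar.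
  by move=> _; exact: nonidentifiable_no_separable.
case=> [|Lbar0]; last by rewrite Lbar0 in Lb0.
by case: M hM => [|[|m]] // _ _; exact: nonidentifiable_separable.
Qed.
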